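(* For any $n\in\mathbb{N}$ with $n\ge 1$, the complete graph $K_n$ on $n$ nodes satisfies $\mathrm{fdim}(K_n)=\lceil\log_2 n\rceil$.
   Context: $\mathbb{N}=\{0,1,2,\dots\}$. Graphs are undirected, without loops or multiple edges. A polytope $P\subset\mathbb{Q}^d$ is a lattice polytope if all its vertices are in $\mathbb{Z}^d$. A finite set $\mathcal{M}\subset\mathbb{Z}^d\setminus\{0\}$ is a set of moves if $\mathcal{M}=-\mathcal{M}$ and if for all $\lambda\in\mathbb{N}$ with $\lambda\ge 2$ and all $m\in\mathcal{M}$, $\lambda\cdot m\notin\mathcal{M}$. For a lattice polytope $P\subset\mathbb{Q}^d$ and a set of moves $\mathcal{M}\subset\mathbb{Z}^d$, the fiber graph $P(\mathcal{M})$ is the graph with node set $P\cap\mathbb{Z}^d$ in which two nodes $u$ and $v$ are adjacent if $u-v\in\mathcal{M}$. The fiber dimension $\mathrm{fdim}(G)$ of a graph $G$ is the smallest $d\in\mathbb{N}$ such that there exist a full dimensional (i.e. $d$-dimensional) lattice polytope $P\subset\mathbb{Q}^d_{\ge 0}$ and a set of moves $\mathcal{M}\subset\mathbb{Z}^d$ with $G\cong P(\mathcal{M})$. *)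

(* Defs.v *)
From HB Require Import structures.
From mathcomp Require Import all_boot all_order all_algebra.
From mathcomp Require Import boolp classical_sets cardinality.
Set Implicit Arguments.
Unset Strict Implicit.
Unset Printing Implicit Defensive.
Import Order.TTheory GRing.Theory Num.Theory.
Local Open Scope classical_set_scope.
Local Open Scope ring_scope.

Record sgraph := SGraph {
  node : Type;
  adj : node -> node -> Prop;
  adj_sym : forall u v, adj u v -> adj v u;
  adj_irrefl : forall u, ~ adj u u }.

Definition graph_iso (G H : sgraph) : Prop :=
  exists2 f : node G -> node H,
    bijective f & forall u v, adj u v <-> adj (f u) (f v).

Definition complete_graph (n : nat) : sgraph :=
  @SGraph 'I_n (fun i j => i <> j)
    (fun _ _ ij => not_eq_sym ij) (fun _ ii => ii erefl).

Section Polytopes.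
Variable d : nat.
Implicit Types S P V : set 'rV[rat]_d.

Definition affine_hull S : set 'rV[rat]_d :=
  [set x | exists m (p : 'I_m -> 'rV[rat]_d) (c : 'I_m -> rat),
    [/\ forall i, S (p i), \sum_i c i = 1 & x = \sum_i c i *: p i]].

Definition convex_hull S : set 'rV[rat]_d :=
  [set x | exists m (p : 'I_m -> 'rV[rat]_d) (c : 'I_m -> rat),
    [/\ forall i, S (p i), forall i, 0 <= c i,
        \sum_i c i = 1 & x = \sum_i c i *: p i]].

(* The dimension of the affine hull; the empty set has none. *)
Definition has_dim S (k : nat) : Prop :=
  exists (p : 'rV[rat]_d) (U : {vspace 'rV[rat]_d}),
    affine_hull S = [set x | x - p \in U] /\ \dim U = k.

Definition polytope P : Prop :=
  exists2 V, finite_set V & P = convex_hull V.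

(* {x} is a face of P: the linear form y |-> y *m a attains its maximum over P
   at x and nowhere else. *)
Definition vertex P (x : 'rV[rat]_d) : Prop :=
  P x /\ exists a : 'cV[rat]_d,
    forall y, P y -> y <> x -> (y *m a) 0 0 < (x *m a) 0 0.

Definition ratv (z : 'rV[int]_d) : 'rV[rat]_d := map_mx intr z.

Definition lattice_polytope P : Prop :=
  polytope P /\ forall x, vertex P x -> exists z, x = ratv z.

Definition nonneg_orthant : set 'rV[rat]_d := [set x | forall i, 0 <= x 0 i].

Record moves := Moves {
  move_set : set 'rV[int]_d;
  moves_finite : finite_set move_set;
  moves_neq0 : ~ move_set 0;
  moves_opp : -%R @` move_set = move_set;
  moves_mul : forall (l : nat) m,
    (2 <= l)%N -> move_set m -> ~ move_set (m *+ l) }.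

Definition lattice_points P : set 'rV[int]_d := [set z | P (ratv z)].

Section FiberGraph.
Variables (P : set 'rV[rat]_d) (M : moves).

Definition fiber_adj (u v : lattice_points P) : Prop := move_set M (val u - val v).

Lemma fiber_adj_sym u v : fiber_adj u v -> fiber_adj v u.
Proof.
by move=> Muv; rewrite /fiber_adj -opprB -moves_opp; exists (val u - val v).
Qed.

Lemma fiber_adj_irrefl u : ~ fiber_adj u u.
Proof. by rewrite /fiber_adj subrr; apply: moves_neq0. Qed.

Definition fiber_graph : sgraph := SGraph fiber_adj_sym fiber_adj_irrefl.

End FiberGraph.
End Polytopes.

Definition fiber_realizable (G : sgraph) (d : nat) : Prop :=
  exists (P : set 'rV[rat]_d) (M : moves d),
    [/\ lattice_polytope P, has_dim P d, P `<=` @nonneg_orthant d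
      & graph_iso G (fiber_graph P M)].

(* fdim(G) = d, as a relation because the minimum need not exist a priori *)
Definition is_fdim (G : sgraph) (d : nat) : Prop :=
  fiber_realizable G d /\ forall d', fiber_realizable G d' -> (d <= d')%N.

(* Main.v *)
Require Import Defs.
From mathcomp Require Import all_boot.
From mathcomp Require Import all_order all_algebra.
From mathcomp Require Import boolp classical_sets functions cardinality.
From mathcomp Require Import zify lra.

(** Lower bound: suppose that [n > 2 ^ d] lattice points of a convex set in
    dimension [d] are pairwise adjacent. Two of them, [u] and [v], agree modulo
    2, so their midpoint [w] is again a lattice point of the set. Now [u - v]
    and [w - v] are both moves by completeness, yet the first is twice the
    second, which the definition of a set of moves forbids. Hence [n <= 2 ^ d]
    ([complete_fiber_graph_card]).

    Upper bound: a subset [A] of the cube [{0, 1}^d] spans a polytope whose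
    lattice points are exactly the elements of [A] ([cube_hull_lattice_points]),
    and the nonzero differences of elements of [A] have entries in [{-1, 0, 1}],
    so that none is a proper multiple of another: they are a set of moves for
    which the fiber graph is complete. The polytope is full dimensional as soon
    as [A] contains the origin and the unit vectors, which is possible for every
    size from [d + 1] to [2 ^ d] ([complete_graph_realizable]). For
    [d = up_log 2 n] both bounds on [n] hold, because
    [n > 2 ^ (d - 1) >= d] when [d > 0]. *)

Set Implicit Arguments.
Unset Strict Implicit.
Unset Printing Implicit Defensive.
Import Order.TTheory GRing.Theory Num.Theory.

Section FiberDimension.
Local Open Scope classical_set_scope.
Local Open Scope ring_scope.

(** * Convex hulls *)

Lemma convex_hull_sub d (S : set 'rV[rat]_d) : S `<=` convex_hull S.
Proof.
move=> x Sx; exists 1%N, (fun=> x), (fun=> 1).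
by split=> //; rewrite big_ord1 ?scale1r.
Qed.

Lemma convex_hull_convex d (S : set 'rV[rat]_d) (t : rat) x y :
    0 <= t <= 1 -> convex_hull S x -> convex_hull S y ->
  convex_hull S (t *: x + (1 - t) *: y).
Proof.
move=> /andP[t0 t1] [m [p [c [Sp c0 c1 ->]]]] [m' [p' [c' [Sp' c0' c1' ->]]]].
exists (m + m')%N, (fun i => match fintype.split i with inl j => p j | inr j => p' j end),
  (fun i => match fintype.split i with
            | inl j => t * c j | inr j => (1 - t) * c' j end).
split=> [i|i||]; try by case: fintype.split.
- by case: fintype.split => j; rewrite mulr_ge0 ?subr_ge0.
- rewrite big_split_ord /=.
  under eq_bigr do rewrite -/(unsplit (inl _)) unsplitK.
  under [X in _ + X]eq_bigr do rewrite -/(unsplit (inr _)) unsplitK.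
  by rewrite -!mulr_sumr c1 c1' !mulr1 subrKC.
- rewrite big_split_ord /= !scaler_sumr; congr (_ + _); apply: eq_bigr => i _.
    by rewrite -/(unsplit (inl _)) unsplitK scalerA.
  by rewrite -/(unsplit (inr _)) unsplitK scalerA.
Qed.

(** A linear form takes at a convex combination at most its largest value on the
    points combined, so a unique maximizer must be one of these points. *)
Lemma vertex_convex_hull d (S : set 'rV[rat]_d) x : vertex (convex_hull S) x -> S x.
Proof.
move=> [[m [p [c [Sp c0 c1 xE]]]] [a xmax]].
case: (pselect (S x)) => // nSx; exfalso.
have lt_p i : (p i *m a) 0 0 < (x *m a) 0 0.
  apply: xmax; first exact/convex_hull_sub.
  by move=> pix; apply: nSx; rewrite -pix.
have gap0 : \sum_i c i * ((x *m a) 0 0 - (p i *m a) 0 0) = 0.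
  under eq_bigr do rewrite mulrBr.
  rewrite sumrB -mulr_suml c1 mul1r {1}xE mulmx_suml summxE.
  by apply/eqP; rewrite subr_eq0; apply/eqP/eq_bigr => i _; rewrite -scalemxAl mxE.
have c_eq0 i : c i = 0.
  have term_ge0 k : true -> 0 <= c k * ((x *m a) 0 0 - (p k *m a) 0 0).
    by move=> _; rewrite mulr_ge0 // subr_ge0 ltW.
  move: (psumr_eq0P term_ge0 gap0 (i := i) isT) => /eqP; rewrite mulf_eq0 => /orP[/eqP//|].
  by rewrite subr_eq0 gt_eqF.
by move: c1; rewrite big1 // => /esym/eqP; rewrite oner_eq0.
Qed.

(** * At most [2 ^ d] pairwise adjacent lattice points *)

Lemma same_parity_half d (u v : 'rV[int]_d) :
    (forall j, odd `|u 0 j| = odd `|v 0 j|) ->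
  exists w, u - v = w *+ 2.
Proof.
move=> par; exists (\row_j divz (u 0 j - v 0 j) 2).
apply/rowP=> j; rewrite mulmxnE !mxE; move: (par j); move: (u 0 j) (v 0 j) => a b; lia.
Qed.

(** Points are sorted by the parities of their coordinates, which leaves
    [2 ^ d] classes; with two points in one class, half of their difference
    leads from one of them to their midpoint and is a move by completeness. *)
Lemma complete_fiber_graph_card n d (P : set 'rV[rat]_d) (M : moves d) :
    (forall x y, P x -> P y -> P (2^-1 *: x + (1 - 2^-1) *: y)) ->
  graph_iso (complete_graph n) (fiber_graph P M) -> (n <= 2 ^ d)%N.
Proof.
move=> midP [/= f [g fK gK] fadj]; rewrite leqNgt; apply/negP => lt_n.
pose parity (i : 'I_n) := [set j | odd `|val (f i) 0 j|]%SET.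
have /injectivePn[i [k ne_ik eq_par]] : ~~ injectiveb parity.
  apply/negP=> /injectiveP/leq_card; rewrite card_ord.
  by rewrite -cardsT -powersetT card_powerset cardsT card_ord leqNgt lt_n.
have [w uvE] : exists w, val (f i) - val (f k) = w *+ 2.
  by apply: same_parity_half => j; move/setP/(_ j): eq_par; rewrite !inE.
have Mw2 : move_set M (w *+ 2).
  by rewrite -uvE; apply/(fadj i k)/eqP.
have w_neq0 : w <> 0.
  by move=> w0; move: Mw2; rewrite w0 mul0rn; apply: moves_neq0.
have Pmid : lattice_points P (val (f k) + w).
  rewrite /lattice_points /=.
  have -> : ratv (val (f k) + w) =
      2^-1 *: ratv (val (f i)) + (1 - 2^-1) *: ratv (val (f k)).
    apply/rowP=> j; move/rowP/(_ j): uvE; rewrite mulmxnE !mxE => uvE.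
    have -> : val (f i) 0 j = w 0 j *+ 2 + val (f k) 0 j by rewrite -uvE subrK.
    by rewrite !intrD; lra.
  by apply: midP; [exact: (set_mem (valP (f i))) | exact: (set_mem (valP (f k)))].
pose l := g (exist (fun z => z \in lattice_points P) _ (mem_set Pmid) : lattice_points P).
have flE : val (f l) = val (f k) + w by rewrite /l gK.
have Mw : move_set M w.
  rewrite -[w](addKr (val (f k))) addrC -flE; apply/(fadj l k) => lk.
  by apply: w_neq0; move: flE; rewrite lk -{1}[val _]addr0 => /addrI.
exact: (@moves_mul _ M 2 w isT Mw Mw2).
Qed.

(** * Polytopes spanned by vertices of the cube *)

Definition indicator_row d (I : {set 'I_d}) : 'rV[int]_d := \row_j (j \in I)%:R.

Lemma indicator_row_inj d : injective (@indicator_row d).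
Proof.
by move=> I J /rowP IJ; apply/setP=> j; move: (IJ j); rewrite !mxE; do 2!case: (_ \in _).
Qed.

Lemma ratv_inj d : injective (@ratv d).
Proof. by move=> u v /rowP uv; apply/rowP=> j; move: (uv j); rewrite !mxE => /intr_inj. Qed.

Lemma indicator_row_diff_eq1 d (I J : {set 'I_d}) : I != J ->
  exists j, `|(indicator_row I - indicator_row J) 0 j| = 1.
Proof.
move=> neIJ; case: (pickP (fun j => (j \in I) != (j \in J))) => [j|eqIJ].
  by move=> ne; exists j; move: ne; rewrite !mxE; do 2!case: (_ \in _).
by case/eqP: neIJ; apply/setP=> j; apply/eqP/negbFE/eqIJ.
Qed.

Lemma indicator_row_diff_le1 d (I J : {set 'I_d}) j :
  `|(indicator_row I - indicator_row J) 0 j| <= 1.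
Proof. by rewrite !mxE; do 2!case: (_ \in _). Qed.

Section CubePolytope.
Variables (d : nat) (A : {set {set 'I_d}}).

Definition cube_points : set 'rV[rat]_d :=
  [set ratv (indicator_row I) | I in [set` A]].

Definition cube_diffs : set 'rV[int]_d :=
  [set m | exists I J, [/\ I \in A, J \in A, I != J
                         & m = indicator_row I - indicator_row J]].

Lemma cube_diffs_finite : finite_set cube_diffs.
Proof.
pose diff (IJ : {set 'I_d} * {set 'I_d}) := indicator_row IJ.1 - indicator_row IJ.2.
apply: (@sub_finite_set _ _ (range diff)); last exact/finite_image/finite_finset.
by move=> m [I [J [_ _ _ ->]]]; exists (I, J).
Qed.

Lemma cube_diffs_neq0 : ~ cube_diffs 0.
Proof.
move=> [I [J [_ _ /eqP neIJ /esym/eqP]]]; rewrite subr_eq0 => /eqP.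
by move/indicator_row_inj.
Qed.

Lemma cube_diffs_opp : -%R @` cube_diffs = cube_diffs.
Proof.
have oppP m : cube_diffs m -> cube_diffs (- m).
  move=> [I [J [AI AJ neIJ ->]]]; exists J, I.
  by split=> //; rewrite ?opprB // eq_sym.
apply/seteqP; split=> [_ [m Dm <-]|m Dm]; first exact: oppP.
by exists (- m); [exact: oppP | rewrite opprK].
Qed.

(** Some entry of a nonzero difference is [1] or [-1], so the multiple by
    [l >= 2] has an entry too large for a difference of cube vertices. *)
Lemma cube_diffs_mul (l : nat) m :
  (2 <= l)%N -> cube_diffs m -> ~ cube_diffs (m *+ l).
Proof.
move=> l2 [I [J [_ _ /indicator_row_diff_eq1[j mj1] ->]]] [I' [J' [_ _ _ mlE]]].
have := indicator_row_diff_le1 I' J' j.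
by rewrite -mlE mulmxnE normrMn mj1; move: l2; lia.
Qed.

Definition cube_moves : moves d :=
  Moves cube_diffs_finite cube_diffs_neq0 cube_diffs_opp cube_diffs_mul.

(** An integral point of the cube is one of its vertices, and a vertex is a
    convex combination only of copies of itself: at each coordinate its value
    is extremal, so every point of positive weight has the same value there. *)
Lemma cube_hull_lattice_points z :
  convex_hull cube_points (ratv z) -> exists2 I, I \in A & z = indicator_row I.
Proof.
move=> [m [p [c [Sp c0 c1 zE]]]].
have [i ci] : exists i, c i != 0.
  apply: contrapT => /forallNP nc; move: c1; rewrite big1 => [/esym/eqP|i _].
    by rewrite oner_eq0.
  by apply/eqP/negPn/negP/nc.
have [I AI pi] := Sp i; exists I => //; apply: ratv_inj; rewrite pi.
have zjE j : (z 0 j)%:~R = \sum_k c k * p k 0 j.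
  by move/rowP/(_ j): zE; rewrite mxE summxE => ->; apply: eq_bigr => k _; rewrite mxE.
have p01 k j : p k 0 j = 0 \/ p k 0 j = 1.
  by have [K _ <-] := Sp k; rewrite !mxE; case: (_ \in _); [right | left].
have p_ge0 k j : 0 <= p k 0 j by case: (p01 k j) => ->.
have p_le1 k j : p k 0 j <= 1 by case: (p01 k j) => ->.
apply/rowP=> j; rewrite [LHS]mxE.
have zj0 : 0 <= z 0 j.
  by rewrite -(ler0z rat) zjE sumr_ge0 // => k _; rewrite mulr_ge0.
have zj1 : z 0 j <= 1.
  by rewrite -(lerz1 rat) zjE -c1 ler_sum // => k _; rewrite ler_piMr.
have [zj|zj] : z 0 j = 0 \/ z 0 j = 1 by lia.
- have sum0 : \sum_k c k * p k 0 j = 0 by rewrite -zjE zj.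
  have /eqP := psumr_eq0P (fun k _ => mulr_ge0 (c0 k) (p_ge0 k j)) sum0 (i := i) isT.
  by rewrite mulf_eq0 (negPf ci) /= zj => /eqP ->.
- have sum0 : \sum_k c k * (1 - p k 0 j) = 0.
    by under eq_bigr do rewrite mulrBr mulr1; rewrite sumrB c1 -zjE zj subrr.
  have dp_ge0 k : 0 <= 1 - p k 0 j by rewrite subr_ge0.
  have /eqP := psumr_eq0P (fun k _ => mulr_ge0 (c0 k) (dp_ge0 k)) sum0 (i := i) isT.
  by rewrite mulf_eq0 (negPf ci) /= subr_eq0 zj => /eqP <-.
Qed.

Lemma cube_hull_lattice_polytope : lattice_polytope (convex_hull cube_points).
Proof.
split; first by exists cube_points => //; apply/finite_image/finite_finset.
by move=> x /vertex_convex_hull[I _ <-]; exists (indicator_row I).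
Qed.

Lemma cube_hull_nonneg : convex_hull cube_points `<=` @nonneg_orthant d.
Proof.
move=> x [m [p [c [Sp c0 _ ->]]]] j; rewrite summxE sumr_ge0 // => k _.
by rewrite mxE mulr_ge0 //; have [K _ <-] := Sp k; rewrite !mxE ler0z ler0n.
Qed.

(** With the origin and the unit vectors at hand, any point is the affine
    combination that has its coordinates as weights on the unit vectors and the
    remaining weight on the origin. *)
Lemma cube_hull_full_dim :
    finset.set0 \in A -> (forall j, [set j]%SET \in A) ->
  has_dim (convex_hull cube_points) d.
Proof.
move=> A0 A1; exists 0, fullv; split; last by rewrite dimvf /dim /= mul1n.
apply/seteqP; split=> x _; first by rewrite /= memvf.
pose I (k : 'I_d.+1) := oapp (fun j => [set j]%SET) finset.set0 (unlift ord0 k).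
pose c k := oapp (fun j => x 0 j) (1 - \sum_j x 0 j) (unlift ord0 k).
exists d.+1, (fun k => ratv (indicator_row (I k))), c; split.
- move=> k; apply: convex_hull_sub; exists (I k) => //=.
  by rewrite /I; case: (unlift _ _).
- rewrite big_ord_recl /c unlift_none /=.
  by under [X in _ + X]eq_bigr do rewrite liftK /=; rewrite subrK.
- apply/rowP=> j; rewrite summxE big_ord_recl /I /c unlift_none /=.
  rewrite !mxE inE mulr0 add0r (bigD1 j) //= liftK !mxE inE eqxx mulr1 /=.
  rewrite big1 ?addr0 // => k nekj.
  by rewrite liftK !mxE inE eq_sym (negPf nekj) mulr0.
Qed.

Lemma cube_fiber_graph_complete :
  graph_iso (complete_graph #|A|) (fiber_graph (convex_hull cube_points) cube_moves).
Proof.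
have hullP (i : 'I_#|A|) :
    lattice_points (convex_hull cube_points) (indicator_row (enum_val i)).
  by apply: convex_hull_sub; exists (enum_val i) => //=; apply: enum_valP.
pose f i : lattice_points (convex_hull cube_points) :=
  exist (fun z => z \in lattice_points _) _ (mem_set (hullP i)).
have f_inj : injective f.
  by move=> i j /(congr1 val)/indicator_row_inj/enum_val_inj.
exists f => [|i j] /=.
- rewrite -setTT_bijective; split=> //; first by move=> i j _ _; apply: f_inj.
  move=> [z Pz] _; have [I AI zE] := cube_hull_lattice_points (set_mem Pz).
  exists (enum_rank_in AI I) => //; apply: val_inj.
  by rewrite /= enum_rankK_in.
- split=> [ne_ij|adj_ij ij]; last first.
    by move: adj_ij; rewrite ij; apply: (@fiber_adj_irrefl _ _ cube_moves (f j)).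
  exists (enum_val i), (enum_val j); split=> //; try exact: enum_valP.
  by apply/eqP => /enum_val_inj.
Qed.

End CubePolytope.

Lemma exists_superset_card (T : finType) (B : {set T}) n :
  (#|B| <= n <= #|T|)%N -> exists2 A : {set T}, B \subset A & #|A| = n.
Proof.
elim: n => [|n IHn] /andP[leBn lenT].
  by exists B => //; apply/eqP; rewrite -leqn0.
have [eqB|ltBn] := eqVneq #|B| n.+1; first by exists B.
have [|A subBA cardA] := IHn; first by rewrite (ltnW lenT) andbT; lia.
have [x] : exists x, x \in ~: A.
  by apply/set0Pn; rewrite -card_gt0 cardsCs finset.setCK cardA subn_gt0.
rewrite inE => nAx; exists (x |: A)%SET; last by rewrite cardsU1 nAx cardA.
exact: fintype.subset_trans subBA (finset.subsetUr _ _).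
Qed.

Lemma complete_graph_realizable n d :
  (d < n <= 2 ^ d)%N -> fiber_realizable (complete_graph n) d.
Proof.
move=> /andP[lt_dn le_n2d].
pose B := (finset.set0 |: [set [set j]%SET | j : 'I_d])%SET.
have leB : (#|B| <= n)%N.
  apply: leq_trans lt_dn; rewrite cardsU1 card_imset ?card_ord; last exact: set1_inj.
  by rewrite -add1n leq_add2r leq_b1.
have [|A subBA cardA] := @exists_superset_card _ B n.
  by rewrite leB -cardsT -powersetT card_powerset cardsT card_ord.
exists (convex_hull (cube_points A)), (cube_moves A); split.
- exact: cube_hull_lattice_polytope.
- apply: cube_hull_full_dim => [|j]; apply: (fintype.subsetP subBA).
    by rewrite !inE eqxx.
  by rewrite inE imset_f ?orbT.
- exact: cube_hull_nonneg.
- by rewrite -cardA; apply: cube_fiber_graph_complete.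
Qed.

End FiberDimension.

(** * The fiber dimension of complete graphs *)

(** Makes room for the origin and the unit vectors among [n] vertices of a cube
    of dimension [up_log 2 n]. *)
Lemma up_log2_lt n : (1 <= n)%N -> (up_log 2 n < n)%N.
Proof.
move=> n_gt0; have [n_gt1|n_le1] := ltnP 1 n; last first.
  by have -> : n = 1%N by lia.
have /andP[lt_n _] := up_log_bounds (isT : (1 < 2)%N) n_gt1.
apply: leq_ltn_trans lt_n.
case: (up_log 2 n) => // e; exact: ltn_expl.
Qed.

(* up_log 2 n is the base-2 logarithm of n rounded up *)
Theorem theorem5p5 (n : nat) (hn : (1 <= n)%N) :
  is_fdim (complete_graph n) (up_log 2 n).
Proof.
split; first by apply: complete_graph_realizable; rewrite up_log2_lt ?up_logP.
move=> d [P [M [[[V _ ->] _] _ _ iso]]]; apply: up_log_min => //.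
by apply: complete_fiber_graph_card iso => x y; apply: convex_hull_convex.
Qed.
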